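(* Let $G$ be an outerplanar graph with $p=|V(G)|$, maximum degree $\Delta$ and $L=L(G)$. Then for every integer $n\geq 3$: $A_n(G)=\{0,1,2\}$ if $n\leq L$; $A_n(G)=\{0,1\}$ if $L<n\leq\Delta$; $A_n(G)=\{0\}$ if $\Delta<n\leq p$; and $A_n(G)=\emptyset$ if $n>p$.
   Context: All graphs are simple and finite. A graph is outerplanar if it admits a planar embedding in which one region contains all vertices on its boundary. For distinct vertices $u_1,\dots,u_n$ of $G$, $N(u_1,\dots,u_n)$ is the set of vertices adjacent to all of them, and $A_n(G):=\{a : \exists \text{ distinct } u_1,\dots,u_n\in V(G) \text{ with } |N(u_1,\dots,u_n)|=a\}$. $L(G):=\max\{\ell\in\mathbb{N} : G \text{ contains } K_{2,\ell} \text{ as a subgraph}\}$, with $L(G)=0$ if there is no $\ell\geq1$ with this property. *)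

(* Defs.v *)
From HB Require Import structures.
From mathcomp Require Import all_boot all_order all_algebra.
From mathcomp Require Import all_classical all_reals all_analysis.
Import numFieldNormedType.Exports.

Set Implicit Arguments.
Unset Strict Implicit.
Unset Printing Implicit Defensive.

Local Open Scope classical_set_scope.

Record sgraph := SGraph {
  vertex :> finType;
  adj : rel vertex;
  adj_sym : symmetric adj;
  adj_irr : irreflexive adj }.

Arguments adj {s}.

Definition max_degree (G : sgraph) : nat :=
  \max_(v : G) #|[pred w : G | adj v w]|.

Definition common_nbrs (G : sgraph) (s : seq G) : {pred G} :=
  [pred w : G | all (fun v => adj v w) s].

(* The set A_n(G) of all values |N(u_1, ..., u_n)|. *)
Definition common_nbr_counts (n : nat) (G : sgraph) : set nat :=
  [set a | exists u : n.-tuple G, uniq u /\ #|common_nbrs u| = a].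

Definition in_left (m n : nat) (x : 'I_m + 'I_n) : bool :=
  if x is inl _ then true else false.

Definition biclique_adj (m n : nat) : rel ('I_m + 'I_n)%type :=
  fun x y => in_left x != in_left y.

Lemma biclique_adj_sym m n : symmetric (@biclique_adj m n).
Proof. by move=> x y; rewrite /biclique_adj eq_sym. Qed.

Lemma biclique_adj_irr m n : irreflexive (@biclique_adj m n).
Proof. by move=> x; rewrite /biclique_adj eqxx. Qed.

Definition biclique (m n : nat) : sgraph :=
  SGraph (@biclique_adj_sym m n) (@biclique_adj_irr m n).

(* H is isomorphic to a (not necessarily induced) subgraph of G. *)
Definition has_subgraph (G H : sgraph) : bool :=
  [exists f : {ffun H -> G},
    injectiveb f && [forall x, forall y, adj x y ==> adj (f x) (f y)]].

(* L(G).  The bound on l loses nothing, as K_{2,l} has l + 2 vertices; the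
   value is 0 when G contains no K_{2,l} with l >= 1. *)
Definition max_K2 (G : sgraph) : nat :=
  \max_(l < #|G|.+1 | has_subgraph G (biclique 2 l)) l.

Section Outerplanar.
Variable R : realType.
Local Open Scope ring_scope.

Local Notation plane := (R * R)%type.

(* A is a simple (Jordan) arc with endpoints a and b. *)
Definition is_arc (a b : plane) (A : set plane) : Prop :=
  exists gamma : R -> plane,
    [/\ {within `[0, 1], continuous gamma},
        {in `[0, 1] &, injective gamma},
        gamma 0 = a, gamma 1 = b & gamma @` `[0, 1] = A].

(* Only the values arc x y with x, y adjacent are meaningful. *)
Record plane_embedding (G : sgraph) (pos : G -> plane)
    (arc : G -> G -> set plane) : Prop := PlaneEmbedding {
  pos_inj : injective pos;
  arc_sym : forall x y, adj x y -> arc x y = arc y x;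
  arc_is_arc : forall x y, adj x y -> is_arc (pos x) (pos y) (arc x y);
  arc_vertex : forall x y z, adj x y -> arc x y (pos z) -> z = x \/ z = y;
  arc_disjoint : forall x y u v, adj x y -> adj u v ->
    [set x; y] <> [set u; v] -> arc x y `&` arc u v `<=` range pos }.

Definition drawing (G : sgraph) (pos : G -> plane) (arc : G -> G -> set plane) :
    set plane :=
  range pos `|` [set p | exists x y, adj x y /\ arc x y p].

Definition is_region (D F : set plane) : Prop :=
  exists2 p, (~` D) p & F = connected_component (~` D) p.

Definition boundary (F : set plane) : set plane := closure F `\` interior F.

Definition outerplanar (G : sgraph) : Prop :=
  exists (pos : G -> plane) (arc : G -> G -> set plane),
    plane_embedding pos arc /\
    exists2 F, is_region (drawing pos arc) F & forall v, boundary F (pos v).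

End Outerplanar.

(* Main.v *)
Require Import Defs.
From mathcomp Require Import all_boot all_order all_algebra.
From mathcomp Require Import all_classical all_reals all_analysis.
From mathcomp Require Import lra.
From Stdlib Require Import Btauto.

Import Order.TTheory GRing.Theory Num.Theory.
Import numFieldNormedType.Exports.

Local Open Scope classical_set_scope.

Set Implicit Arguments.
Unset Strict Implicit.
Unset Printing Implicit Defensive.

(** An outerplanar graph contains neither K_4 nor K_{2,3}; this is the only way
in which planarity enters, and everything else is counting.

Counting.  Two distinct vertices have at most two common neighbours, by
K_{2,3}-freeness [card_common_nbrs2].  Hence L(G) <= 2 [max_K2_le2], so the case
3 <= n <= L does not occur, and n >= 3 vertices have at most one common
neighbour [card_common_nbrs3].  For n <= Delta the value 1 is attained by n
neighbours of a vertex v.  The value 0 is attained by v together with n - 1 of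
its neighbours, except perhaps when n = 3 and v and its neighbours a, b have a
common neighbour w; in that case v, a, w have none, as such a vertex would
complete a K_4 or a K_{2,3} [exists_no_common_nbrs].  A common neighbour
of n vertices has degree at least n, which settles n > Delta.

Excluded subgraphs.  Let F be a region with all vertices on its boundary.  Every
vertex v can be joined to a fixed point of F by a curve that avoids all edges
not incident with v: move inside F, which is open and connected, to a point
close to v, and finish with a short segment [outerplanar_cone].  This turns a
K_4 (resp. a K_{2,3}) into a drawing of K_5 (resp. K_{3,3}) in which edges
without a common end are disjoint; edges with a common end may well cross.

Such drawings do not exist [K5_nonplanar], [K33_nonplanar].  No general position
and no Jordan curve theorem is needed, only angles modulo 2.  For a curve g and
a point q not on it, let turns(g, q) be the parity of the number of times
that g - q crosses the positive horizontal half-axis.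
If the curves g and d are disjoint, g(s) - d(t) does not vanish on the unit
square, so the total parity along the boundary of the square is even.  As z and
-z lie on opposite sides of the horizontal axis, this reads
  turns(g, d 0) + turns(g, d 1) + turns(d, g 0) + turns(d, g 1)
    = sum over the ends x of g and y of d of upper(x - y)  (mod 2)
[turns_disjoint].  Summing over all pairs of edges of K_5 or K_{3,3} without a
common end, every term turns(e, x) occurs an even number of times, whereas the
right-hand sides add up to 1 because upper(y - x) = 1 - upper(x - y)
[K5_pair_parity], [K33_pair_parity]. *)

(** * Parity count over the independent edge pairs of K_5 and K_{3,3} *)

Section ParityCount.
Variables (t : nat -> nat -> nat -> bool) (u : nat -> nat -> bool).

(** For edges ij and kl without a common end: t i j k stands for the turning
parity of the edge ij around the vertex k, and u i k for the side on which
vertex i lies of the horizontal line through vertex k. *)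
Definition pair_parity i j k l : bool :=
  t i j k (+) t i j l (+) (t k l i (+) t k l j) (+)
  (u i k (+) u i l (+) (u j k (+) u j l)).

Lemma addb_xorb a b : a (+) b = xorb a b.
Proof. by case: a; case: b. Qed.

Lemma K5_pair_parity : (forall i j, i < j < 5 -> u j i = ~~ u i j) ->
  (forall i j k l, i < j < 5 -> k < l < 5 -> uniq [:: i; j; k; l] ->
    pair_parity i j k l = false) -> False.
Proof.
move=> uN t0.
(* The 15 pairs of disjoint edges; in their sum all variables cancel. *)
have : \big[addb/false]_(s <- [:: (0,1,2,3); (0,1,2,4); (0,1,3,4); (0,2,1,3);
    (0,2,1,4); (0,2,3,4); (0,3,1,2); (0,3,1,4); (0,3,2,4); (0,4,1,2); (0,4,1,3);
    (0,4,2,3); (1,2,3,4); (1,3,2,4); (1,4,2,3)])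
    pair_parity s.1.1.1 s.1.1.2 s.1.2 s.2 = false.
  by rewrite !big_cons big_nil !t0.
rewrite !big_cons big_nil /pair_parity /= !addb_xorb.
rewrite (uN 1 2)// (uN 1 3)// (uN 2 3)// (uN 1 4)// (uN 2 4)// (uN 3 4)//.
match goal with |- ?sum = false -> _ => have -> : sum = true by btauto end.
by [].
Qed.

Lemma K33_pair_parity : (forall i j, i < j < 6 -> u j i = ~~ u i j) ->
  (forall i j k l, i < 3 <= j -> j < 6 -> k < 3 <= l -> l < 6 ->
    uniq [:: i; j; k; l] -> pair_parity i j k l = false) -> False.
Proof.
move=> uN t0.
(* The 18 pairs of disjoint edges between {0, 1, 2} and {3, 4, 5}. *)
have : \big[addb/false]_(s <- [:: (0,3,1,4); (0,3,1,5); (0,4,1,3); (0,4,1,5);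
    (0,5,1,3); (0,5,1,4); (0,3,2,4); (0,3,2,5); (0,4,2,3); (0,4,2,5);
    (0,5,2,3); (0,5,2,4); (1,3,2,4); (1,3,2,5); (1,4,2,3); (1,4,2,5);
    (1,5,2,3); (1,5,2,4)])
    pair_parity s.1.1.1 s.1.1.2 s.1.2 s.2 = false.
  by rewrite !big_cons big_nil !t0.
rewrite !big_cons big_nil /pair_parity /= !addb_xorb.
rewrite (uN 1 3)// (uN 1 4)// (uN 1 5)// (uN 2 3)// (uN 2 4)// (uN 2 5)//.
rewrite (uN 3 4)// (uN 3 5)// (uN 4 5)//.
match goal with |- ?sum = false -> _ => have -> : sum = true by btauto end.
by [].
Qed.
End ParityCount.

(** * Turning parity of plane curves *)

Section TurningParity.
Variable R : realType.
Local Open Scope ring_scope.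
Local Notation plane := (R * R)%type.
Implicit Types (z w : plane) (g d : R -> plane).

(** The half-open upper half-plane: of two opposite nonzero vectors it contains
exactly one. *)
Definition upper z : bool := (0 < z.2) || ((z.2 == 0) && (0 < z.1)).

(** Whether a short step from z to w crosses the positive horizontal half-axis.
Testing the first coordinate of z only is enough for steps that are short
compared with the distance to the origin. *)
Definition hop z w : bool := (upper z (+) upper w) && (0 < z.1).

(** Parity of the number of crossings with the positive horizontal half-axis of
g - q, where g is restricted to [0, 1] and sampled at the multiples of
1 / (n + 1). *)
Definition turns (n : nat) g (q : plane) : bool :=
  \big[addb/false]_(0 <= i < n.+1)
    hop (g (i%:R / n.+1%:R) - q) (g (i.+1%:R / n.+1%:R) - q).

Lemma upperN z : z != 0 -> upper (- z) = ~~ upper z.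
Proof.
case: z => a b; rewrite /upper /= -[_ == 0]/((a == 0) && (b == 0)) => z0.
rewrite !oppr_gt0 oppr_eq0.
move: z0; case: (ltgtP b 0) => //= _; rewrite ?andbT ?andbF //.
by case: ltgtP.
Qed.

(** Around a nonzero point either the sign of the first coordinate or the half-plane
is constant, according to whether the first coordinate vanishes at that point. *)
Lemma sign_or_upper_near z : z != 0 ->
  (z.1 != 0 /\ \forall w \near z, w.1 != 0 /\ (0 < w.1) = (0 < z.1)) \/
  \forall w \near z, upper w = upper z.
Proof.
case: z => a b; rewrite -[_ == 0]/((a == 0) && (b == 0)) negb_and => z0.
have [a0|a0] := eqVneq a 0; last first.
  left; split=> //.
  have : (fun w : plane => w.1) @ nbhs (a, b) --> a by exact: cvg_fst.
  case/orP: (lt_total a0) => /= a0' fa.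
    have : \forall w \near (a, b), w.1 < 0 by exact: (cvgr_lt _ fa).
    by apply: filterS => w w0; rewrite lt_eqF// (lt_gtF w0) (lt_gtF a0').
  have : \forall w \near (a, b), 0 < w.1 by exact: (cvgr_gt _ fa).
  by apply: filterS => w w0; rewrite gt_eqF// w0 a0'.
right; move: z0; rewrite a0 eqxx /= => b0.
have fb : (fun w : plane => w.2) @ nbhs ((0, b) : plane) --> b by exact: cvg_snd.
rewrite /upper /=; case/orP: (lt_total b0) => b0'.
  have : \forall w \near ((0, b) : plane), w.2 < 0 by exact: (cvgr_lt _ fb).
  by apply: filterS => w w0; rewrite (lt_eqF w0) (lt_eqF b0') (lt_gtF w0) (lt_gtF b0').
have : \forall w \near ((0, b) : plane), 0 < w.2 by exact: (cvgr_gt _ fb).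
by apply: filterS => w w0; rewrite w0 b0'.
Qed.

(** Locally away from the origin, hop is a cocycle, and the crossings of the
positive and the negative half-axis add up to those of the whole axis. *)
Lemma hop_near z : z != 0 -> exists2 B, nbhs z B &
  {in B & &, forall x y w, hop x y (+) hop y w = hop x w} /\
  {in B &, forall x y, hop (- x) (- y) = hop x y (+) (upper x (+) upper y)}.
Proof.
move=> z0.
have nz : \forall w \near z, w != 0.
  by exact: (@cvgr_neq0 R plane plane (nbhs z) _ id z cvg_id z0).
case: (sign_or_upper_near z0) => [[z10 zB]|zB].
  exists [set w | w != 0 /\ w.1 != 0 /\ (0 < w.1) = (0 < z.1)].
    by apply: filterI.
  split.
    move=> x y w; rewrite !inE => -[_ [_ hx]] [_ [_ hy]] [_ [_ hw]].
    rewrite /hop hx hy; case: (0 < z.1); rewrite ?andbF ?andbT //.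
    by case: (upper x); case: (upper y); case: (upper w).
  move=> x y; rewrite !inE => -[x0 [x10 hx]] [y0 [_ hy]].
  rewrite /hop (upperN x0) (upperN y0) oppr_gt0.
  have -> : (x.1 < 0) = ~~ (0 < x.1).
    by rewrite -leNgt le_eqVlt (negPf x10).
  by case: (0 < x.1); case: (upper x); case: (upper y).
exists [set w | w != 0 /\ upper w = upper z]; first by apply: filterI.
split.
  move=> x y w; rewrite !inE => -[_ hx] [_ hy] [_ hw].
  by rewrite /hop hx hy hw addbb.
move=> x y; rewrite !inE => -[x0 hx] [y0 hy].
by rewrite /hop !upperN// hx hy !addbb.
Qed.

Lemma addb_telescope (f : nat -> bool) n :
  \big[addb/false]_(0 <= i < n) (f i (+) f i.+1) = f 0%N (+) f n.
Proof.
elim: n => [|n IHn]; first by rewrite big_nil addbb.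
by rewrite big_nat_recr//= IHn addbA addbK.
Qed.

(** The good behaviour of the differences g - d on the square of side h with
lower left corner st: the parities of the two ways from its lower left to its
upper right corner agree, and the vertical sides obey the sign change rule. *)
Definition cell g d (h : R) (st : R * R) : Prop :=
  let z00 := g st.1 - d st.2 in let z10 := g (st.1 + h) - d st.2 in
  let z01 := g st.1 - d (st.2 + h) in let z11 := g (st.1 + h) - d (st.2 + h) in
  [/\ hop z00 z10 (+) hop z10 z11 = hop z00 z01 (+) hop z01 z11,
      hop (- z00) (- z01) = hop z00 z01 (+) (upper z00 (+) upper z01)
    & hop (- z10) (- z11) = hop z10 z11 (+) (upper z10 (+) upper z11)].

Lemma cell_near g d : continuous g -> continuous d ->
  {in `[0, 1] &, forall s t, g s != d t} ->
  \forall n \near \oo, forall st, (`[0, 1] `*` `[0, 1])%classic st ->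
    cell g d n.+1%:R^-1 st.
Proof.
move=> cg cd gd.
(* Compactness of the unit square makes the local statement uniform in n. *)
have cptI : compact (`[0%R, 1%R] `*` `[0%R, 1%R] : set (R * R)).
  by apply: compact_setX; exact: segment_compact.
apply: (iffLR (compact_near_coveringP _) cptI) => -[s t] [/= sI tI].
have [] := @hop_near (g s - d t); first by rewrite subr_eq0 gd.
move=> B zB [hopD hopN].
have shift (a : R) (f : R * R -> R) (st : R * R) : f @ nbhs st --> f st ->
    (fun y : (R * R) * nat => f y.1 + a * y.2.+1%:R^-1) @ (nbhs st, \oo) -->
      f st.
  move=> cf; rewrite -[X in _ --> X]addr0 -[X in _ + X](mulr0 a).
  apply: cvgD; first exact: cvg_comp cvg_fst cf.
  apply: cvgM; first exact: cvg_cst.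
  exact: cvg_comp cvg_snd (@cvg_harmonic R).
have corner (a b : R) : \forall st' \near (s, t) & n \near \oo,
    B (g (st'.1 + a * n.+1%:R^-1) - d (st'.2 + b * n.+1%:R^-1)).
  suff : (fun y : (R * R) * nat => g (y.1.1 + a * y.2.+1%:R^-1) -
      d (y.1.2 + b * y.2.+1%:R^-1)) @ (nbhs (s, t), \oo) --> g s - d t.
    by apply; exact: zB.
  apply: cvgB.
    exact: (cvg_comp _ _ (shift a fst (s, t) cvg_fst) (cg s)).
  exact: (cvg_comp _ _ (shift b snd (s, t) cvg_snd) (cd t)).
refine (filterS _ (filterI (filterI (corner 0 0) (corner 1 0))
                           (filterI (corner 0 1) (corner 1 1)))).
move=> [[s' t'] n] /=; rewrite !mul0r !mul1r !addr0.
move=> -[[z00 z10] [z01 z11]].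
by split; rewrite /= ?hopN ?hopD// inE.
Qed.

(** A finite form of turns_disjoint, obtained by adding up the cells of a grid on
the unit square: first over columns, then over rows. *)
Lemma turns_cells g d (n : nat) :
  (forall st, (`[0, 1] `*` `[0, 1])%classic st -> cell g d n.+1%:R^-1 st) ->
  turns n g (d 0) (+) turns n g (d 1) (+) (turns n d (g 0) (+) turns n d (g 1)) =
  upper (g 0 - d 0) (+) upper (g 0 - d 1) (+)
    (upper (g 1 - d 0) (+) upper (g 1 - d 1)).
Proof.
move=> cells.
pose T k : R := k%:R / n.+1%:R; pose Z i j := g (T i) - d (T j).
have T0 : T 0%N = 0 by rewrite /T mul0r.
have TN : T n.+1 = 1 by rewrite /T divff.
have {}cells i j : (i < n.+1)%N -> (j < n.+1)%N -> cell g d n.+1%:R^-1 (T i, T j).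
  move=> iN jN; apply: cells; split; rewrite /= in_itv /= divr_ge0//=;
  by rewrite ler_pdivrMr// mul1r ler_nat ltnW.
have TS k : T k + n.+1%:R^-1 = T k.+1 by rewrite /T -[k.+1%:R]natr1 mulrDl mul1r.
pose H i j := hop (Z i j) (Z i.+1 j); pose V i j := hop (Z i j) (Z i j.+1).
have column i : (i < n.+1)%N ->
    \big[addb/false]_(0 <= j < n.+1) V i j (+)
    \big[addb/false]_(0 <= j < n.+1) V i.+1 j = H i 0%N (+) H i n.+1.
  move=> iN; rewrite -big_split -addb_telescope /=.
  apply: eq_big_nat => j /andP[_ jN].
  have [+ _ _] := cells i j iN jN; rewrite /= !TS -!/(Z _ _) -!/(H _ _) -!/(V _ _).
  by case: (H i j); case: (H i j.+1); case: (V i j); case: (V i.+1 j).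
have rows : turns n g (d 0) (+) turns n g (d 1) =
    \big[addb/false]_(0 <= j < n.+1) V 0%N j (+)
    \big[addb/false]_(0 <= j < n.+1) V n.+1 j.
  rewrite -(addb_telescope (fun i => \big[addb/false]_(0 <= j < n.+1) V i j)).
  rewrite /turns -big_split /=; apply: eq_big_nat => i /andP[_ iN].
  by rewrite column// /H /Z T0 TN.
have flip k : (k = 0)%N \/ (k = n.+1)%N ->
    turns n d (g (T k)) = \big[addb/false]_(0 <= j < n.+1) V k j (+)
      (upper (Z k 0%N) (+) upper (Z k n.+1)).
  move=> kE; rewrite -(addb_telescope (fun j => upper (Z k j))) -big_split /=.
  apply: eq_big_nat => j /andP[_ jN]; rewrite -/(T _) -/(T _).
  rewrite -(opprB _ (d (T j))) -(opprB _ (d (T j.+1))).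
  case: kE => ->.
    by have [_ + _] := cells 0%N j (ltn0Sn _) jN; rewrite /= !TS.
  by have [_ _] := cells n j (ltnSn _) jN; rewrite /= !TS.
rewrite rows -T0 -TN !flip; [|by right|by left].
rewrite /Z.
do 2!case: (\big[_/_]_(0 <= j < _) _).
all: by do 4!case: (upper _).
Qed.

(** Disjoint curves: the parities along the boundary of the unit square of the
nowhere vanishing function g s - d t add up to zero, once the sampling is fine
enough. *)
Lemma turns_disjoint g d : continuous g -> continuous d ->
  {in `[0, 1] &, forall s t, g s != d t} ->
  \forall n \near \oo,
  turns n g (d 0) (+) turns n g (d 1) (+) (turns n d (g 0) (+) turns n d (g 1)) =
  upper (g 0 - d 0) (+) upper (g 0 - d 1) (+)
    (upper (g 1 - d 0) (+) upper (g 1 - d 1)).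
Proof.
by move=> cg cd gd; apply: filterS (cell_near cg cd gd) => n; exact: turns_cells.
Qed.

(** A single sampling that is fine enough for all pairs of independent edges of a
drawing with vertices p i, i < m, and edges c i j for e i j. *)
Lemma disjoint_pair_parity (m : nat) (e : rel nat) (p : nat -> plane)
    (c : nat -> nat -> R -> plane) :
  (forall i j, e i j -> [/\ continuous (c i j), c i j 0 = p i & c i j 1 = p j]) ->
  (forall i j k l, e i j -> e k l -> uniq [:: i; j; k; l] ->
    {in `[0, 1] &, forall s t, c i j s != c k l t}) ->
  exists n, forall i j k l, (i < m)%N -> (j < m)%N -> (k < m)%N -> (l < m)%N ->
    e i j -> e k l -> uniq [:: i; j; k; l] ->
    pair_parity (fun i j k => turns n (c i j) (p k))
                (fun i j => upper (p i - p j)) i j k l = false.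
Proof.
move=> cP cD.
suff : \forall n \near \oo, forall x : 'I_m * 'I_m * 'I_m * 'I_m,
    e x.1.1.1 x.1.1.2 -> e x.1.2 x.2 ->
    uniq [:: val x.1.1.1; val x.1.1.2; val x.1.2; val x.2] ->
    pair_parity (fun i j k => turns n (c i j) (p k))
      (fun i j => upper (p i - p j)) x.1.1.1 x.1.1.2 x.1.2 x.2 = false.
  move=> /filter_ex[n nP]; exists n => i j k l im jm km lm.
  exact: (nP (Ordinal im, Ordinal jm, Ordinal km, Ordinal lm)).
apply: filter_forall => -[[[i j] k] l] /=.
have [eij|/negP] := boolP (e i j); last by move=> ne; apply: nearW.
have [ekl|/negP] := boolP (e k l); last by move=> ne; apply: nearW.
have [u4|/negP] := boolP (uniq [:: val i; val j; val k; val l]); last first.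
  by move=> ne; apply: nearW.
have [cij ci cj] := cP _ _ eij; have [ckl ck cl] := cP _ _ ekl.
have := turns_disjoint cij ckl (cD _ _ _ _ eij ekl u4).
apply: filterS => n + _ _ _; rewrite ci cj ck cl /pair_parity => ->.
by rewrite addbb.
Qed.

(** In any drawing of K_5 by continuous curves, some two edges without a common
end intersect. *)
Lemma K5_nonplanar (p : nat -> plane) (c : nat -> nat -> R -> plane) :
  (forall i j, (i < j < 5)%N -> p i != p j) ->
  (forall i j, (i < j < 5)%N ->
    [/\ continuous (c i j), c i j 0 = p i & c i j 1 = p j]) ->
  ~ (forall i j k l, (i < j < 5)%N -> (k < l < 5)%N -> uniq [:: i; j; k; l] ->
    {in `[0, 1] &, forall s t, c i j s != c k l t}).
Proof.
move=> pI cP cD.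
have [n nP] := disjoint_pair_parity 5 cP cD.
apply: K5_pair_parity => [i j ij|i j k l ij kl]; last first.
  have [/andP[i_j j5] /andP[k_l l5]] := (ij, kl).
  by apply: nP => //; [exact: ltn_trans j5 | exact: ltn_trans l5].
by rewrite -upperN ?opprB// subr_eq0 pI.
Qed.

(** The same for K_{3,3}, with classes {0, 1, 2} and {3, 4, 5}. *)
Lemma K33_nonplanar (p : nat -> plane) (c : nat -> nat -> R -> plane) :
  (forall i j, (i < j < 6)%N -> p i != p j) ->
  (forall i j, (i < 3 <= j)%N && (j < 6)%N ->
    [/\ continuous (c i j), c i j 0 = p i & c i j 1 = p j]) ->
  ~ (forall i j k l, (i < 3 <= j)%N && (j < 6)%N -> (k < 3 <= l)%N && (l < 6)%N ->
    uniq [:: i; j; k; l] -> {in `[0, 1] &, forall s t, c i j s != c k l t}).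
Proof.
move=> pI cP cD.
have [n nP] := disjoint_pair_parity 6 cP cD.
apply: K33_pair_parity => [i j ij|i j k l ij j6 kl l6]; last first.
  have [/andP[i3 _] /andP[k3 _]] := (ij, kl).
  by apply: nP; rewrite ?ij ?kl//; [exact: ltn_trans i3 _ | exact: ltn_trans k3 _].
by rewrite -upperN ?opprB// subr_eq0 pI.
Qed.

End TurningParity.

(** * Curves in regions of a plane drawing *)

Section Curves.
Variable R : realType.
Local Open Scope ring_scope.
Local Notation plane := (R * R)%type.
Implicit Types (a b p q : plane) (A U : set plane) (g : R -> plane).

(** g runs from a to b inside A during the time [0, 1].  It is continuous on the
whole line, outside [0, 1] its values do not matter. *)
Definition curve A a b g : Prop :=
  [/\ continuous g, g 0 = a, g 1 = b & {in `[0, 1], forall t, A (g t)}].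

(* The retraction of the line onto [0, 1], written Num.max 0 (Num.min 1 t), serves
   to extend a path that is only continuous within [0, 1]. *)
Lemma clamp_itv (t : R) : Num.max 0 (Num.min 1 t) \in `[0, 1].
Proof. by rewrite in_itv /= le_max lexx ge_max ler01 ge_min lexx. Qed.

Lemma clamp_id (t : R) : t \in `[0, 1] -> Num.max 0 (Num.min 1 t) = t.
Proof. by rewrite in_itv /= => /andP[t0 t1]; rewrite min_r// max_r. Qed.

Lemma maxc_continuous (c : R) (f : R -> R) :
  continuous f -> continuous (fun t => Num.max c (f t)).
Proof.
move=> cf t; exact: (@continuous_max _ _ _ _ t (@cst_continuous _ _ c t) (cf t)).
Qed.

Lemma minc_continuous (c : R) (f : R -> R) :
  continuous f -> continuous (fun t => Num.min c (f t)).
Proof.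
move=> cf t; exact: (@continuous_min _ _ _ _ t (@cst_continuous _ _ c t) (cf t)).
Qed.

Lemma clamp_continuous : continuous (fun t : R => Num.max 0 (Num.min 1 t)).
Proof.
by apply/maxc_continuous/minc_continuous => t; exact: cvg_id.
Qed.

Lemma arc_curve a b A : is_arc a b A -> exists g, curve A a b g.
Proof.
move=> [gamma [cg _ g0 g1 gA]].
exists (fun t => gamma (Num.max 0 (Num.min 1 t))); split.
- move=> t.
  have := (iffLR (subspace_continuousP _ _) cg) _ (clamp_itv t).
  apply: (@cvg_comp _ _ _ (fun t => Num.max 0 (Num.min 1 t)) gamma) => B wB.
  have wBc : nbhs t (fun s => Num.max 0 (Num.min 1 s) \in `[0, 1] ->
      B (Num.max 0 (Num.min 1 s))) := clamp_continuous wB.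
  by apply: filterS wBc => s; apply; exact: clamp_itv.
- by rewrite clamp_id// in_itv /= lexx ler01.
- by rewrite clamp_id// in_itv /= lexx ler01.
- by move=> t tI; rewrite -gA; exists (Num.max 0 (Num.min 1 t)) => //; exact: clamp_itv.
Qed.

Lemma arc_closed a b A : is_arc a b A -> closed A.
Proof.
move=> [gamma [cg _ _ _ <-]]; apply: compact_closed; first exact: norm_hausdorff.
by apply: continuous_compact => //; exact: segment_compact.
Qed.

Lemma curve_sub A B a b g : A `<=` B -> curve A a b g -> curve B a b g.
Proof. by move=> AB [cg g0 g1 gA]; split=> // t /gA /AB. Qed.

Lemma ball_segment p (r : R) a b (t : R) : t \in `[0, 1] ->
  ball p r a -> ball p r b -> ball p r (a + t *: (b - a)).
Proof.
rewrite in_itv /= -ball_normE /= => /andP[t0 t1] pa pb.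
have -> : p - (a + t *: (b - a)) = (1 - t) *: (p - a) + t *: (p - b).
  rewrite scalerBl scale1r !scalerBr !opprD !opprK !addrA.
  by rewrite [RHS](AC 6 (1*2*6*5*3*4))/= addrK.
rewrite (le_lt_trans (ler_normD _ _))// !normrZ (ger0_norm t0).
rewrite ger0_norm ?subr_ge0//.
have [->|t_neq0] := eqVneq t 0; first by rewrite subr0 mul1r mul0r addr0.
have -> : r = (1 - t) * r + t * r by rewrite mulrBl mul1r subrK.
apply: ler_ltD; first by rewrite ler_wpM2l ?subr_ge0// ltW.
by rewrite ltr_pM2l// lt_neqAle eq_sym t_neq0.
Qed.

(** A curve ending in a ball inside A can be prolonged by a segment to any other
point of that ball. *)
Lemma curve_extend A a b b' g p (r : R) : curve A a b g -> ball p r `<=` A ->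
  ball p r b -> ball p r b' -> exists g', curve A a b' g'.
Proof.
move=> [cg g0 g1 gA] pA pb pb'.
(* Run through g on [0, 1/2] and through the segment from b to b' on [1/2, 1]. *)
exists (fun t => g (Num.min 1 (2 * t)) + Num.max 0 (2 * t - 1) *: (b' - b)).
have c2 : continuous (fun t : R => 2 * t).
  by move=> t; apply: cvgM; [exact: cvg_cst|exact: cvg_id].
split.
- move=> t; apply: cvgD.
    apply: (@cvg_comp _ _ _ (fun t => Num.min 1 (2 * t)) g).
      exact: (minc_continuous c2 (x := t)).
    exact: cg.
  apply: cvgZr_tmp.
  apply: (@maxc_continuous 0 (fun t => 2 * t - 1)) => s.
  by apply: cvgB; [exact: c2|exact: cvg_cst].
- by rewrite mulr0 min_r// g0 sub0r max_l ?scale0r ?addr0// oppr_le0.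
- rewrite mulr1 min_l ?ler1n// g1 (_ : 2 - 1 = 1); last by lra.
  by rewrite max_r// scale1r addrC subrK.
move=> t; rewrite in_itv /= => /andP[t0 t1].
have [t2|t2] := leP (2 * t) 1.
  rewrite max_l ?subr_le0// scale0r addr0; apply: gA.
  by rewrite in_itv /= t2 mulr_ge0.
rewrite max_r ?subr_ge0 1?ltW// g1.
by apply/pA/ball_segment => //; rewrite in_itv /=; lra.
Qed.

(** Components of open sets are path-connected: the points that can be reached
from p form a relatively open and closed subset. *)
Lemma component_curve U p q : open U -> U p -> connected_component U p q ->
  exists g, curve U p q g.
Proof.
move=> oU Up Fq.
pose S := [set x | exists g, curve U p x g].
have step x (r : R) y z : ball x r `<=` U -> ball x r y -> ball x r z -> S y -> S z.
  by move=> xU xy xz [g gC]; exact: curve_extend gC xU xy xz.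
have ballU x : U x -> exists2 r : R, 0 < r & ball x r `<=` U.
  by move=> Ux; have /nbhs_ballP[r r0 rU] := open_nbhs_nbhs (conj oU Ux); exists r.
have oS : open S.
  rewrite openE => x Sx.
  have [r r0 rU] : exists2 r : R, 0 < r & ball x r `<=` U.
    by apply: ballU; case: Sx => g [_ _ <-]; apply; rewrite in_itv /= ler01 lexx.
  apply/nbhs_ballP; exists r => // y xy.
  exact: (step x r x y rU (ballxx x r0) xy Sx).
have oUS : open (U `\` S).
  rewrite openE => x [Ux nSx]; have [r r0 rU] := ballU x Ux.
  apply/nbhs_ballP; exists r => // y xy; split; first exact: rU.
  by move=> Sy; apply: nSx; exact: (step x r y x rU xy (ballxx x r0) Sy).
set F := connected_component U p in Fq.
have FU : F `<=` U by exact: connected_component_sub.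
suff SF : F `&` S = F by move: Fq; rewrite -SF => -[].
apply: (@component_connected _ U p).
- exists p; split; first exact: connected_component_refl.
  exists (cst p); split=> //; exact: cst_continuous.
- by exists S.
- exists (~` (U `\` S)); first exact: open_closedC.
  apply/seteqP; split=> x [Fx]; first by move=> Sx; split=> // -[].
  by move=> nS; split=> //; apply: contrapT => nSx; apply: nS; split=> //; exact: FU.
Qed.

(** Adjacency in the cone over G, whose apex is None.  Edges at the apex are taken
in the direction away from the apex only. *)
Definition cone_adj (G : sgraph) (x y : option G) : bool :=
  match x, y with
  | None, Some _ => true
  | Some x, Some y => adj x y
  | _, None => false
  end.

Lemma closed_exists (T : topologicalType) (I : finType) (f : I -> set T) :
  (forall i, closed (f i)) -> closed [set p | exists i, f i p].
Proof.
move=> fc; rewrite (_ : mkset _ = \bigcup_(i in setT) f i).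
  by apply: closed_bigcup => //; exact: finite_finset.
by apply/seteqP; split=> p [i]; [exists i|exists i].
Qed.

(** The union of the arcs selected by e is closed. *)
Lemma closed_arcs (G : sgraph) (pos : G -> plane) (arc : G -> G -> set plane)
    (e : rel G) : plane_embedding pos arc ->
  closed [set p | exists xy : G * G, [/\ adj xy.1 xy.2, e xy.1 xy.2 & arc xy.1 xy.2 p]].
Proof.
move=> emb; apply: closed_exists => -[x y] /=.
have [/andP[xy exy]|nxy] := boolP (adj x y && e x y).
  rewrite [X in closed X](_ : _ = arc x y); last by apply/seteqP; split=> p // [].
  exact: arc_closed (arc_is_arc emb xy).
rewrite [X in closed X](_ : _ = set0); first exact: closed0.
by rewrite -subset0 => p [xy exy _]; move: nxy; rewrite xy exy.
Qed.

Lemma closed_drawing (G : sgraph) (pos : G -> plane) (arc : G -> G -> set plane) :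
  plane_embedding pos arc -> closed (drawing pos arc).
Proof.
move=> emb; apply: closedU.
  rewrite (_ : range pos = [set p | exists x, [set pos x] p]).
    apply: closed_exists => x.
    exact/accessible_closed_set1/hausdorff_accessible/norm_hausdorff.
  by apply/seteqP; split=> p /=; [move=> [x _ <-]; exists x|move=> [x ->]; exists x].
have := @closed_arcs G pos arc (fun _ _ => true) emb; congr closed.
by apply/seteqP; split=> p /= => [[[x y] [xy _ p_xy]]|[x [y [xy p_xy]]]];
  [exists x, y|exists (x, y)].
Qed.

(** The cone over an outerplanar graph has a drawing in which edges without a
common end are disjoint; the apex lies in the region that has all vertices on its
boundary. *)
Lemma outerplanar_cone (G : sgraph) : outerplanar R G ->
  exists (pos : option G -> plane) (c : option G -> option G -> R -> plane),
  [/\ injective pos,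
      forall x y, cone_adj x y ->
        [/\ continuous (c x y), c x y 0 = pos x & c x y 1 = pos y]
    & forall x y z w, cone_adj x y -> cone_adj z w -> uniq [:: x; y; z; w] ->
        {in `[0, 1] &, forall s t, c x y s != c z w t}].
Proof.
move=> [pos [arc [emb [F [p0 nDp0 FE] bd]]]].
(* U v is the complement of the edges not incident with v. *)
pose U v := ~` [set p | exists xy : G * G,
  [/\ adj xy.1 xy.2, (v != xy.1) && (v != xy.2) & arc xy.1 xy.2 p]].
have oU v : open (U v).
  apply: closed_openC.
  exact: (@closed_arcs G pos arc (fun x y => (v != x) && (v != y)) emb).
have DU v : ~` drawing pos arc `<=` U v.
  by apply: subsetC => p /= [[x y] [xy _ p_xy]]; right; exists x, y.
have Uv v : U v (pos v).
  move=> [[x y] [/= xy /andP[vx vy] p_xy]].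
  by have [vE|vE] := arc_vertex emb xy p_xy; [move: vx|move: vy]; rewrite vE eqxx.
have spoke v : exists g, curve (U v) p0 (pos v) g.
  have /nbhs_ballP[r r0 rU] := open_nbhs_nbhs (conj (oU v) (Uv v)).
  have [clF _] := bd v.
  have [q [Fq vq]] := clF _ (nbhsx_ballx (pos v) r r0).
  have oD : open (~` drawing pos arc) by apply/closed_openC/closed_drawing.
  move: Fq; rewrite FE => /(component_curve oD nDp0)[g /(curve_sub (@DU v)) gU].
  exact: curve_extend gU rU vq (ballxx _ r0).
pose pos' (x : option G) := if x is Some v then pos v else p0.
(* The set in which the curve from x to y is to run. *)
pose A (x y : option G) : set plane :=
  match x, y with
  | None, Some v => U v | Some x, Some y => arc x y | _, None => setT
  end.
have /choice[c cP] : forall xy : option G * option G, exists g, cone_adj xy.1 xy.2 ->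
    curve (A xy.1 xy.2) (pos' xy.1) (pos' xy.2) g.
  move=> [[x|] [y|]] /=; try by exists (cst 0).
    have [xy|xy] := boolP (adj x y); last by exists (cst 0).
    by have [g gP] := arc_curve (arc_is_arc emb xy); exists g.
  by have [g gP] := spoke y; exists g.
exists pos', (fun x y => c (x, y)); split.
- have p0pos v : p0 != pos v.
    by apply/eqP => p0E; apply: nDp0; left; exists v.
  move=> [x|] [y|] //= => [/(pos_inj emb)->//|/eqP|/eqP].
    by rewrite eq_sym (negPf (p0pos _)).
  by rewrite (negPf (p0pos _)).
- by move=> x y /(cP (x, y))[].
move=> x y z w /[dup] /(cP (x, y))[_ _ _ /= Axy] xy.
move=> /[dup] /(cP (z, w))[_ _ _ /= Azw] zw u4 s t sI tI; apply/eqP => E.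
move: (Axy s sI) (Azw t tI); rewrite -E; move: (c (x, y) s) => p {E Axy Azw}.
case: x y z w xy zw u4 => [x|] [y|] // [z|] [w|] //= xy zw; rewrite !inE !negb_or.
- move=> /andP[/and3P[_ nxz nxw] /andP[/andP[nyz nyw] _]] pxy pzw.
  have sets_neq : [set x; y] <> [set z; w].
    move=> /seteqP[/(_ x (or_introl erefl))].
    by move=> [] xE; [move: nxz|move: nxw]; rewrite xE eqxx.
  have [u _ uE] := arc_disjoint emb xy zw sets_neq (conj pxy pzw).
  move: pxy pzw; rewrite -uE => /(arc_vertex emb xy) uxy /(arc_vertex emb zw) uzw.
  move: nxz nxw nyz nyw.
  by case: uxy uzw => -> [] ->; rewrite eqxx ?andbF.
- move=> /andP[/and3P[_ _ nxw] /andP[/andP[_ nyw] _]] pxy; apply.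
  by exists (x, y); split=> //=; rewrite ![w == _]eq_sym nxw.
- move=> /andP[/andP[nyz nyw] _] Up pzw; apply: Up.
  by exists (z, w); split=> //=; rewrite nyz.
Qed.

End Curves.

(** * Common neighbours in outerplanar graphs *)

Lemma map_nth_uniq (T : eqType) (x0 : T) (s : seq T) (r : seq nat) :
  uniq s -> all (gtn (size s)) r -> uniq r -> uniq (map (nth x0 s) r).
Proof.
move=> us /allP rs ur; rewrite map_inj_in_uniq// => i j /rs i_s /rs j_s /eqP.
by rewrite nth_uniq// => /eqP.
Qed.

Section OuterplanarGraphs.
Variables (R : realType) (G : sgraph).
Hypothesis outerG : outerplanar R G.
Implicit Types (v w : G) (s : seq G).

Lemma adj_neq v w : adj v w -> v != w.
Proof. by apply: contraTneq => ->; rewrite adj_irr. Qed.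

Lemma outerplanar_K4_free (a b c d : G) :
  adj a b -> adj a c -> adj a d -> adj b c -> adj b d -> adj c d -> False.
Proof.
move=> ab ac ad bc bd cd; have [pos [g [posI gP gD]]] := outerplanar_cone outerG.
(* The apex joined to K_4 gives K_5. *)
pose s := [:: None; Some a; Some b; Some c; Some d].
have adj_s i j : i < j < 5 -> cone_adj (nth None s i) (nth None s j).
  by move: i j => [|[|[|[|[|i]]]]] [|[|[|[|[|j]]]]] //=; rewrite ?ltnS ?andbF.
have uniq_s : uniq s.
  rewrite -[uniq s]/(uniq (None :: map Some [:: a; b; c; d])) /=.
  rewrite !inE !negb_or !(inj_eq (@Some_inj _)).
  by rewrite (adj_neq ab) (adj_neq ac) (adj_neq ad) (adj_neq bc) (adj_neq bd)
             (adj_neq cd).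
apply: (@K5_nonplanar R (fun i => pos (nth None s i))
                        (fun i j => g (nth None s i) (nth None s j))).
- move=> i j /andP[ij j5]; rewrite (inj_eq posI) nth_uniq ?ltn_eqF//.
  exact: ltn_trans j5.
- by move=> i j /adj_s /gP.
- move=> i j k l ij kl u4; apply: gD; [exact: adj_s|exact: adj_s|].
  apply: (@map_nth_uniq _ None s [:: i; j; k; l]) => //=.
  have [/andP[i_j j5] /andP[k_l l5]] := (ij, kl).
  by rewrite j5 l5 (ltn_trans i_j j5) (ltn_trans k_l l5).
Qed.

Lemma outerplanar_K23_free (a b c1 c2 c3 : G) : a != b -> uniq [:: c1; c2; c3] ->
  all (adj a) [:: c1; c2; c3] -> all (adj b) [:: c1; c2; c3] -> False.
Proof.
move=> ab uc /and4P[ac1 ac2 ac3 _] /and4P[bc1 bc2 bc3 _].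
have [pos [g [posI gP gD]]] := outerplanar_cone outerG.
(* The apex joins the class of a and b, which gives K_{3,3}. *)
pose s := [:: None; Some a; Some b; Some c1; Some c2; Some c3].
have adj_s i j : (i < 3 <= j) && (j < 6) -> cone_adj (nth None s i) (nth None s j).
  by move: i j => [|[|[|i]]] [|[|[|[|[|[|j]]]]]] //=; rewrite ?ltnS ?andbF.
have uniq_s : uniq s.
  move: uc.
  rewrite -[uniq s]/(uniq (None :: map Some [:: a; b; c1; c2; c3])) /=.
  rewrite !inE !negb_or !(inj_eq (@Some_inj _)) ab.
  rewrite (adj_neq ac1) (adj_neq ac2) (adj_neq ac3).
  by rewrite (adj_neq bc1) (adj_neq bc2) (adj_neq bc3).
apply: (@K33_nonplanar R (fun i => pos (nth None s i))
                         (fun i j => g (nth None s i) (nth None s j))).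
- move=> i j /andP[ij j6]; rewrite (inj_eq posI) nth_uniq ?ltn_eqF//.
  exact: ltn_trans j6.
- by move=> i j /adj_s /gP.
- move=> i j k l ij kl u4; apply: gD; [exact: adj_s|exact: adj_s|].
  apply: (@map_nth_uniq _ None s [:: i; j; k; l]) => //=.
  have [/andP[/andP[i3 _] j6] /andP[/andP[k3 _] l6]] := (ij, kl).
  by rewrite j6 l6 (ltn_trans i3)// (ltn_trans k3).
Qed.

Lemma card_common_nbrs2 (a b : G) : a != b -> #|common_nbrs [:: a; b]| <= 2.
Proof.
move=> ab; rewrite leqNgt; apply/negP => /card_geqP[s [uc]].
case: s uc => [|c1 [|c2 [|c3 []]]] // uc _ cN.
have cP c : c \in [:: c1; c2; c3] -> adj a c && adj b c.
  by move=> /cN; rewrite inE /= andbT.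
by apply: (outerplanar_K23_free ab uc); apply/allP => c /cP /andP[].
Qed.

Lemma max_K2_le2 : max_K2 G <= 2.
Proof.
apply/bigmax_leqP => l /existsP[f /andP[/injectiveP fI /forallP fP]].
have ab : f (inl ord0) != f (inl ord_max) by apply/eqP => /fI.
apply: leq_trans (card_common_nbrs2 ab).
have hI : injective (fun i : 'I_l => f (inr i)) by move=> i j /fI [].
rewrite -[X in X <= _]card_ord -(card_codom hI).
apply/subset_leq_card/fintype.subsetP => _ /codomP[i ->].
by rewrite inE /= andbT; apply/andP; split; apply: (implyP (forallP (fP _) _)).
Qed.

Lemma card_common_nbrs3 s : uniq s -> 3 <= size s -> #|common_nbrs s| <= 1.
Proof.
move=> us s3; rewrite leqNgt; apply/negP => /card_geqP[r [ur]].
case: r ur => [|a [|b []]] //; rewrite /= inE andbT => ab _ abN.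
move: s3; apply/negP; rewrite -leqNgt; apply: leq_trans (card_common_nbrs2 ab).
rewrite -(card_uniqP us); apply/subset_leq_card/fintype.subsetP => x xs.
rewrite inE /= andbT; apply/andP; split; rewrite adj_sym.
  by have /allP := abN a (mem_head _ _); apply.
by have /allP := abN b (mem_last a [:: b]); apply.
Qed.

Lemma common_nbrs_degree s : uniq s -> max_degree G < size s ->
  #|common_nbrs s| = 0.
Proof.
move=> us sD; apply/eqP/pred0P => w /=; apply/negP => /allP wP.
move: sD; apply/negP; rewrite -leqNgt; apply: leq_trans (leq_bigmax w).
rewrite -(card_uniqP us); apply/subset_leq_card/fintype.subsetP => x xs.
by rewrite inE adj_sym wP.
Qed.

Lemma degree_seq n : 0 < n <= max_degree G ->
  exists v s, [/\ uniq s, size s = n & all (adj v) s].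
Proof.
case/andP=> n0 nD.
suff [v /card_geqP[s [us sn sN]]] : exists v, n <= #|[pred w : G | adj v w]|.
  by exists v, s; split=> //; apply/allP => x /sN; rewrite inE.
apply/existsP; apply: contraLR nD; rewrite negb_exists -ltnNge => /forallP deg.
rewrite -(prednK n0) ltnS; apply/bigmax_leqP => v _.
by rewrite -ltnS prednK// ltnNge deg.
Qed.

(** The value 0 is attained.  For n >= 4, a vertex v and n - 1 of its neighbours
will do, as a common neighbour w would share n - 1 >= 3 neighbours with v. *)
Lemma exists_no_common_nbrs n : 3 <= n <= max_degree G ->
  exists s, [/\ uniq s, size s = n & #|common_nbrs s| = 0].
Proof.
case/andP=> n3 nD.
have [|v [s [us sn vs]]] := @degree_seq n.-1.
  by rewrite (leq_trans (leq_pred n) nD) andbT -subn1 subn_gt0 (leq_trans _ n3).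
have uvs : uniq (v :: s).
  rewrite /= us andbT; apply/negP => /(allP vs).
  by rewrite adj_irr.
have svs : size (v :: s) = n by rewrite /= sn prednK// (leq_trans _ n3).
have [/card0_eq N0|] := posnP #|common_nbrs (v :: s)|.
  by exists (v :: s); split=> //; apply: eq_card0.
case/card_gt0P=> w; rewrite inE /= => /andP[vw sw].
have vsw := adj_neq vw.
(* All of s is adjacent to both v and w, so n = 3. *)
have s2 : size s <= 2.
  apply: leq_trans (card_common_nbrs2 vsw); rewrite -(card_uniqP us).
  apply/subset_leq_card/fintype.subsetP => x xs; rewrite inE /= andbT.
  by rewrite (allP vs)//= adj_sym (allP sw).
have {n3 nD} nE : n = 3.
  by apply/eqP; rewrite eqn_leq n3 andbT -svs /=.
move: s us sn vs uvs svs sw s2; rewrite nE => -[|a [|b []]] //= _ _.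
move=> /and3P[va vb _] /andP[]; rewrite !inE !negb_or => /andP[nva nvb] /andP[nab _].
move=> _ /and3P[aw bw _] _.
(* A common neighbour z of v, a, w gives the K_4 on v, a, b, w if z = b, and
   otherwise a third common neighbour of v and w. *)
exists [:: v; a; w]; split=> //=.
  by rewrite !inE !negb_or nva vsw (adj_neq aw).
apply: eq_card0 => z; rewrite inE /= andbT; apply/negP => /and3P[vz az wz].
have [zb|zb] := eqVneq z b.
  rewrite zb in az wz.
  exact: (@outerplanar_K4_free v a b w).
apply: (outerplanar_K23_free vsw (c1 := a) (c2 := b) (c3 := z)).
- by rewrite /= !inE negb_or nab (adj_neq az) eq_sym zb.
- by rewrite /= va vb vz.
- by rewrite /= ![adj w _]adj_sym aw bw adj_sym wz.
Qed.

Lemma common_nbr_countsP n a : common_nbr_counts n G a <->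
  exists s, [/\ uniq s, size s = n & #|common_nbrs s| = a].
Proof.
split=> [[u [uu ua]]|[s [us sn sa]]]; first by exists u; rewrite size_tuple.
by move/eqP: sn => sn; exists (Tuple sn).
Qed.

Lemma common_nbr_counts01 n : 3 <= n <= max_degree G ->
  common_nbr_counts n G = [set 0%N; 1%N].
Proof.
move=> /[dup] n3D /andP[n3 nD]; apply/seteqP; split=> a.
  move=> /common_nbr_countsP[s [us sn <-]].
  have := card_common_nbrs3 us; rewrite sn => /(_ n3) /=.
  by case: #|_| => [|[|]] // _; [left|right].
move=> [->|->]; apply/common_nbr_countsP; first exact: exists_no_common_nbrs.
have [|v [s [us sn vs]]] := @degree_seq n; first by rewrite nD (leq_trans _ n3).
exists s; split=> //; apply/eqP; rewrite eqn_leq card_common_nbrs3 ?sn//.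
by apply/card_gt0P; exists v; rewrite inE; apply/allP => x /(allP vs); rewrite adj_sym.
Qed.

Lemma common_nbr_counts0 n : max_degree G < n <= #|G| ->
  common_nbr_counts n G = [set 0%N].
Proof.
move=> /andP[Dn nG]; apply/seteqP; split=> a.
  by move=> /common_nbr_countsP[s [us sn <-]]; rewrite /= common_nbrs_degree ?sn.
move=> ->; apply/common_nbr_countsP; have [s [us sn _]] := card_geqP nG.
by exists s; split=> //; rewrite common_nbrs_degree ?sn.
Qed.

Lemma common_nbr_counts_empty n : #|G| < n -> common_nbr_counts n G = set0.
Proof.
move=> Gn; rewrite -subset0 => a /common_nbr_countsP[s [us sn _]].
by move: Gn; rewrite -sn -(card_uniqP us) ltnNge max_card.
Qed.

End OuterplanarGraphs.

Theorem corollaryB1 (R : realType) (G : sgraph) (hG : outerplanar R G)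
    (n : nat) (hn : 3 <= n) :
  [/\ n <= max_K2 G -> common_nbr_counts n G = [set 0%N; 1%N; 2%N],
      max_K2 G < n <= max_degree G -> common_nbr_counts n G = [set 0%N; 1%N],
      max_degree G < n <= #|G| -> common_nbr_counts n G = [set 0%N]
    & #|G| < n -> common_nbr_counts n G = set0].
Proof.
split.
- by move=> nK; have := leq_trans hn (leq_trans nK (max_K2_le2 hG)).
- by move=> /andP[_ nD]; apply: (common_nbr_counts01 hG); rewrite hn nD.
- exact: common_nbr_counts0.
- exact: common_nbr_counts_empty.
Qed.
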